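(* For every positive integer $k$, there exists a cyclically $k$-edge-connected bipartite cubic graph $G$ such that $|V(G)| \equiv 0 \pmod 4$.
   Context: All graphs are finite and simple. A cubic graph is a $3$-regular graph. For an integer $k$, a connected cubic graph $G$ which contains two (vertex-)disjoint cycles is said to be cyclically $k$-edge-connected if deleting any set of at most $k-1$ edges from $G$ does not separate $G$ into two components both of which have a cycle. *)

(* Defs.v *)
From mathcomp Require Import all_boot.

Set Implicit Arguments.
Unset Strict Implicit.
Unset Printing Implicit Defensive.

Record sgraph := SGraph {
  vertex :> finType;
  adj : rel vertex;
  adj_sym : symmetric adj;
  adj_irr : irreflexive adj }.

Definition neighbours (G : sgraph) (x : G) : {set G} := [set y | adj x y].

Definition cubic (G : sgraph) : Prop := forall x : G, #|neighbours x| = 3.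

Definition bipartite (G : sgraph) : Prop :=
  exists A : {set G}, forall x y : G, adj x y -> (x \in A) != (y \in A).

Definition edges (G : sgraph) : {set {set G}} :=
  [set [set p.1; p.2] | p in [set p : G * G | adj p.1 p.2]].

(* The vertices of a cycle are listed in cyclic order; the size condition
   rules out the empty list and the two-element list [:: x; y], for which
   [ucycle] holds as soon as x and y are adjacent. *)
Definition is_cycle (G : sgraph) (c : seq G) : Prop :=
  ucycle (@adj G) c /\ 2 < size c.

Definition contains_cycle (G : sgraph) (A : {set G}) : Prop :=
  exists c : seq G, is_cycle c /\ {subset c <= A}.

Definition two_disjoint_cycles (G : sgraph) : Prop :=
  exists c1 c2 : seq G, [/\ is_cycle c1, is_cycle c2 & [disjoint c1 & c2]].

Definition components (G : sgraph) : {set {set G}} :=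
  [set [set y | connect (@adj G) x y] | x : G].

Definition connected (G : sgraph) : Prop := #|components G| = 1.

Section DeleteEdges.
Variables (G : sgraph) (F : {set {set G}}).

Definition del_adj : rel G := fun x y => adj x y && ([set x; y] \notin F).

Lemma del_adj_sym : symmetric del_adj.
Proof. by move=> x y; rewrite /del_adj adj_sym setUC. Qed.

Lemma del_adj_irr : irreflexive del_adj.
Proof. by move=> x; rewrite /del_adj adj_irr. Qed.

Definition del_edges : sgraph := SGraph del_adj_sym del_adj_irr.

End DeleteEdges.

(* F separates two components with a cycle when two distinct components of
   G - F contain cycles; G - F may have further components. *)
Definition cyclically_separating (G : sgraph) (F : {set {set G}}) : Prop :=
  exists A B : {set del_edges F},
    [/\ A \in components (del_edges F), B \in components (del_edges F),
        A != B, contains_cycle A & contains_cycle B].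

(* The notion is only defined for connected cubic graphs having two disjoint
   cycles, so these requirements are part of the predicate. *)
Definition cyclically_edge_connected (k : nat) (G : sgraph) : Prop :=
  [/\ connected G, cubic G, two_disjoint_cycles G &
      forall F : {set {set G}}, F \subset edges G -> #|F| <= k - 1 ->
        ~ cyclically_separating F].

(* Main.v *)
(* The witness is a Cayley graph of a finite group generated by three
   involutions [t i].  The group acts on the ball of radius [4 * k] in the
   Cayley tree of the free product of three copies of Z/2, which forces the
   girth to exceed [4 * k], and on three extra bits, the generator [t i]
   flipping bit [i]; the bits make the graph bipartite of order divisible by 4
   and exhibit two disjoint cycles.  By the girth, a nonempty set of at most
   [4 * k] vertices induces a forest, so it has more boundary edges than
   vertices.  Suppose some set with boundary smaller than [k] is large on both
   sides, and take one with least boundary and then least size.  Submodularity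
   of the boundary shows that its left translates are pairwise disjoint or
   equal.  Hence one of them is a subgroup; it is proper, so its boundary is at
   least as large as itself, a contradiction. *)
Require Import Defs.
From mathcomp Require Import all_boot all_fingroup.
From mathcomp Require Import zify.

Set Implicit Arguments.
Unset Strict Implicit.
Unset Printing Implicit Defensive.

(** * Cycles from minimum degree two *)

(** A path cannot outgrow [S], so it reaches a head whose neighbours in [S] all lie on the path. One
    of them is not the next vertex and closes a cycle. *)
Lemma min_degree2_cycle (G : sgraph) (S : {set G}) :
  S != set0 -> (forall x, x \in S -> 1 < #|neighbours x :&: S|) ->
  contains_cycle S.
Proof.
case/set0Pn=> x0 x0S degS.
have grow n : contains_cycle S \/
    exists x p, [/\ path (@adj G) x p, uniq (x :: p), {subset x :: p <= S}
                  & size p = n].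
  elim: n => [|n [|[x [p [xp up pS sp]]]]]; [right | by left |].
    by exists x0, [::]; split=> // y; rewrite inE => /eqP->.
  have xS : x \in S by apply: pS; rewrite mem_head.
  have [/existsP[y /and3P[xy yS yp]]|noext] :=
      boolP [exists y, [&& adj x y, y \in S & y \notin x :: p]].
    right; exists y, (x :: p); split=> //=.
    - by rewrite adj_sym xy.
    - by rewrite yp.
    - by move=> z; rewrite inE => /predU1P[->|/pS].
    - by rewrite sp.
  left.
  have /card_gt1P[y1 [y2 [y1N y2N neq_y]]] := degS x xS.
  have [y yN yhd] : exists2 y, y \in neighbours x :&: S & y != head x p.
    have [y1h|] := eqVneq y1 (head x p); last by exists y1.
    by exists y2; rewrite // -y1h eq_sym.
  move: yN; rewrite !inE => /andP[xy yS].
  have yp : y \in p.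
    move: noext; rewrite negb_exists => /forallP/(_ y).
    rewrite xy yS negbK inE => /predU1P[xx|//].
    by rewrite xx adj_irr in xy.
  move: xp up pS yhd; case/path.splitP: yp => p1 p2.
  rewrite cat_path -cat_cons cat_uniq => /andP[xp1 _] /and3P[up1 _ _] pS yhd.
  exists (x :: rcons p1 y); split; last first.
    by move=> z zp; apply: pS; rewrite mem_cat zp.
  split; last by case: p1 yhd {xp1 up1 pS} => [|z p1 _] /=;
    rewrite ?eqxx ?size_rcons.
  by rewrite /ucycle up1 /= rcons_path xp1 last_rcons adj_sym xy.
have [//|[x [p [_ up pS sp]]]] := grow #|S|.
have /card_uniqP up' := up.
have : #|x :: p| <= #|S| by apply/subset_leq_card/subsetP.
by rewrite up' /= sp ltnn.
Qed.

(** * Cayley graphs of three involutions and their girth *)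

Definition reduced (w : seq 'I_3) := sorted (fun i j => i != j) w.

Section CayleyGraph.
Variables (gT : finGroupType) (t : 'I_3 -> gT).
Hypotheses (tt : forall i, (t i * t i = 1)%g) (t_inj : injective t)
  (t_neq1 : forall i, t i != 1%g).

Definition cayley_adj : rel gT := fun x y => [exists i, y == (x * t i)%g].

Lemma mul_tK x i : (x * t i * t i = x)%g.
Proof. by rewrite -mulgA tt mulg1. Qed.

Lemma cayley_sym : symmetric cayley_adj.
Proof.
suff H x y : cayley_adj x y -> cayley_adj y x by move=> x y; apply/idP/idP=> /H.
by case/existsP=> i /eqP->; apply/existsP; exists i; rewrite mul_tK.
Qed.

Lemma cayley_irr : irreflexive cayley_adj.
Proof.
move=> x; apply/existsP=> -[i]; rewrite -{1}[x]mulg1.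
by rewrite (inj_eq (mulgI x)) eq_sym (negPf (t_neq1 i)).
Qed.

Definition cayley : sgraph := SGraph cayley_sym cayley_irr.

Lemma cayley_adjP (x y : cayley) :
  reflect (exists i, y = (x * t i)%g) (adj x y).
Proof. by apply: (iffP existsP) => -[i /eqP]; exists i => //; apply/eqP. Qed.

Lemma cayley_adj_mulr (x : gT) i : adj (x : cayley) (x * t i)%g.
Proof. by apply/cayley_adjP; exists i. Qed.

Lemma mul_t_inj (x : gT) : injective (fun i => x * t i)%g.
Proof. by move=> i j /mulgI/t_inj. Qed.

Lemma neighbours_cayley (x : cayley) :
  neighbours x = [set (x * t i)%g | i : 'I_3].
Proof.
apply/setP=> y; rewrite inE.
apply/cayley_adjP/imsetP => [[i ->]|[i _ ->]]; by exists i.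
Qed.

Lemma cubic_cayley : cubic cayley.
Proof.
move=> x; rewrite neighbours_cayley card_imset ?card_ord //.
exact: mul_t_inj.
Qed.

Fixpoint walk (x : gT) (w : seq 'I_3) : seq gT :=
  if w is i :: w' then (x * t i)%g :: walk (x * t i)%g w' else [::].

Lemma path_walk (x : cayley) p :
  path (@adj cayley) x p -> exists w, p = walk x w.
Proof.
elim: p x => [|y p IHp] x /=; first by exists [::].
case/andP=> /cayley_adjP[i ->] /IHp[w ->]; by exists (i :: w).
Qed.

Lemma size_walk x w : size (walk x w) = size w.
Proof. by elim: w x => //= i w IHw x; rewrite IHw. Qed.

Lemma last_walk x w : last x (walk x w) = (x * \prod_(i <- w) t i)%g.
Proof.
elim: w x => /= [|i w IHw] x; first by rewrite big_nil mulg1.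
by rewrite IHw big_cons mulgA.
Qed.

(** A repeated letter would lead back to the vertex two steps earlier. *)
Lemma uniq_walk_reduced x w : uniq (x :: walk x w) -> reduced w.
Proof.
elim: w x => // i [|j w] // IHw x /andP[xw uw].
apply/andP; split; last exact: IHw uw.
by apply: contraNneq xw => <- /=; rewrite mul_tK !inE eqxx orbT.
Qed.

Variable g : nat.
Hypothesis girth : forall w, reduced w -> 0 < size w < g ->
  (\prod_(i <- w) t i)%g != 1%g.

(** The labels along a cycle form a reduced word with product 1. *)
Lemma cayley_girth (c : seq cayley) : is_cycle c -> g <= size c.
Proof.
case: c => [[]|x p] // [/andP[xp up] sc]; rewrite leqNgt; apply/negP=> small.
have [w def_p] := path_walk xp.
have sw : size w = size (x :: p).
  by rewrite -(size_walk x) -def_p size_rcons.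
have red_w : reduced w.
  case: w def_p sw => [|i [|j w]] // def_p sw.
  (* Without its start the closed walk has distinct vertices, so only the first two letters remain
     to be compared. *)
  have upx : uniq (walk x [:: i, j & w]) by rewrite -def_p rcons_uniq.
  apply/andP; split; last exact: (@uniq_walk_reduced (x * t i)%g (j :: w)).
  apply: contraTneq up => ij; move: def_p sc {sw small}.
  case: p {xp} => [|y [|z p]] //= [_ -> _ _].
  by rewrite -ij mul_tK !inE eqxx orbT.
have := girth red_w; rewrite sw small /= => /(_ isT)/eqP; apply.
by apply: (mulgI x); rewrite mulg1 -last_walk -def_p last_rcons.
Qed.

Lemma cycle_card_ge (S : {set cayley}) : contains_cycle S -> g <= #|S|.
Proof.
case=> c [cc cS]; apply: leq_trans (cayley_girth cc) _.
have [/andP[_ /card_uniqP <-] _] := cc.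
exact/subset_leq_card/subsetP.
Qed.

(** * Edge boundaries and the forest bound *)

(** Edges are counted as pairs of start and label: an edge inside [S] occurs twice in [inner S], an
    edge leaving [S] once in [boundary S]. *)
Definition inner (S : {set gT}) : {set gT * 'I_3} :=
  [set p | (p.1 \in S) && (p.1 * t p.2 \in S)%g].

Definition boundary (S : {set gT}) : {set gT * 'I_3} :=
  [set p | (p.1 \in S) && (p.1 * t p.2 \notin S)%g].

Lemma card_inner_boundary S : #|inner S| + #|boundary S| = 3 * #|S|.
Proof.
have disj : inner S :&: boundary S = set0.
  by apply/setP=> p; rewrite !inE; case: (p.1 \in S); rewrite //= andbN.
have -> : #|inner S| + #|boundary S| = #|inner S :|: boundary S|.
  by rewrite -cardsUI disj cards0 addn0.
have -> : inner S :|: boundary S = setX S setT.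
  by apply/setP=> p; rewrite !inE -andb_orr orbN.
by rewrite cardsX cardsT card_ord mulnC.
Qed.

(* By [girth], such a set induces a forest: remove a vertex of degree at most
   1. *)
Lemma card_inner_small (S : {set gT}) :
  0 < #|S| < g -> #|inner S| + 2 <= 2 * #|S|.
Proof.
have [n] := ubnP #|S|; elim: n S => // n IHn S leSn /andP[S_gt0 ltSg].
have [v vS deg_v] : exists2 v, v \in S & #|[set i | (v * t i)%g \in S]| <= 1.
  apply/exists_inP; rewrite -[X in is_true X]negbK negb_exists_in.
  apply/negP=> /forall_inP big.
  suff /cycle_card_ge : contains_cycle (S : {set cayley}).
    by rewrite leqNgt ltSg.
  apply: min_degree2_cycle => [|x xS]; first by rewrite -card_gt0.
  have := big x xS; rewrite -ltnNge => /leq_trans; apply.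
  rewrite -(card_imset _ (@mul_t_inj x)) subset_leq_card //.
  apply/subsetP=> y /imsetP[i]; rewrite inE => xiS ->.
  by rewrite inE xiS andbT inE cayley_adj_mulr.
set D := [set i | _] in deg_v.
(* A pair in [inner S] avoids [v], starts at [v] or ends at [v]; removing [v] thus loses at most two
   pairs. *)
have sub : inner S \subset
    (inner (S :\ v) :|: [set (v, i) | i in D])
      :|: [set ((v * t i)%g, i) | i in D].
  apply/subsetP=> -[x i]; rewrite !inE /= => /andP[xS xiS].
  have [xv|xv] /= := eqVneq x v.
    rewrite -xv; apply/orP; left; apply/imsetP; exists i => //.
    by rewrite inE -xv.
  rewrite xS xiS andbT /=; have [xiv|//] := eqVneq.
  apply/orP; right; apply/imsetP; exists i; rewrite ?inE -xiv mul_tK //.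
have le_inner : #|inner S| <= #|inner (S :\ v)| + #|D| + #|D|.
  apply: leq_trans (subset_leq_card sub) _.
  apply: leq_trans (leq_card_setU _ _) _; apply: leq_add (leq_imset_card _ _).
  apply: leq_trans (leq_card_setU _ _) _; rewrite leq_add2l.
  exact: leq_imset_card.
have cS := cardsD1 v S; rewrite vS add1n in cS.
have [S'0|S'_gt0] := posnP #|S :\ v|.
  suff -> : inner S = set0 by rewrite cards0; lia.
  apply/setP=> -[x i]; rewrite !inE /=; apply/negP=> /andP[xS xiS].
  have /eqP S'E : S :\ v == set0 by rewrite -cards_eq0 S'0.
  have inS y : y \in S -> y = v.
    move=> yS; apply/eqP; apply: contraT => yv.
    by have := in_set0 y; rewrite -S'E !inE yv yS.
  have := cayley_adj_mulr x i; rewrite (inS _ xiS) (inS _ xS).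
  by rewrite adj_irr.
(* [lia] does not identify cardinals taken at different [finType] instances. *)
have := IHn (S :\ v); move: leSn ltSg cS S'_gt0 le_inner deg_v {sub}.
move: #|inner S| #|inner (S :\ v)| #|D| => s s' d.
by move: #|S| #|S :\ v| => m m'; lia.
Qed.

Lemma boundary_small (S : {set gT}) : 0 < #|S| < g -> #|S| + 2 <= #|boundary S|.
Proof.
move=> small; have := card_inner_small small.
by have := card_inner_boundary S; lia.
Qed.

(** Reversing each pair exchanges the two boundaries. *)
Lemma card_boundaryC S : #|boundary (~: S)| = #|boundary S|.
Proof.
pose f (p : gT * 'I_3) := ((p.1 * t p.2)%g, p.2).
have fK : involutive f by case=> x i; rewrite /f /= mul_tK.
rewrite -(card_imset _ (inv_inj fK)); apply: eq_card => p.
apply/imsetP/idP=> [[q qS ->]|pS].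
  by move: qS; rewrite !inE /= mul_tK negbK andbC.
exists (f p); rewrite ?fK //.
by move: pS; rewrite !inE /= mul_tK negbK andbC.
Qed.

Lemma boundary_submodular A B :
  #|boundary (A :&: B)| + #|boundary (A :|: B)|
    <= #|boundary A| + #|boundary B|.
Proof.
rewrite -!sum1_card ![\sum_(_ in boundary _) _]big_mkcond -!big_split.
apply: leq_sum => p _ /=.
by rewrite !inE; do 4!case: (_ \in _).
Qed.

(** Submodularity for [A] and [~: B], whose union is the complement of [B :\: A]. *)
Lemma boundary_setD A B :
  #|boundary (A :\: B)| + #|boundary (B :\: A)|
    <= #|boundary A| + #|boundary B|.
Proof.
have := boundary_submodular A (~: B).
rewrite -(card_boundaryC (_ :|: _)) setCU setCK (card_boundaryC B).
by rewrite !setDE [B :&: _]setIC.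
Qed.

(** Left translation commutes with the right multiplications that define the edges. *)
Lemma card_boundary_lcoset A x : #|boundary (x *: A)%g| = #|boundary A|.
Proof.
pose f (p : gT * 'I_3) := ((x * p.1)%g, p.2).
have f_inj : injective f by case=> y i [z j] [/mulgI-> ->].
rewrite -[RHS](card_imset _ f_inj); apply: eq_card => p; apply/idP/imsetP.
  rewrite inE !mem_lcoset => pA; exists ((x^-1 * p.1)%g, p.2).
    by rewrite inE /= -mulgA.
  by rewrite /f /= mulKVg; case: (p).
case=> q qA ->; move: qA; rewrite !inE !mem_lcoset /=.
by rewrite -mulgA !mulKg.
Qed.


(** The union has [2 * #|A| - #|A :&: B|] elements, and [2 * #|A|] is at most the group order. *)
Lemma setU_compl_ge (A B : {set gT}) :
  #|A| = #|B| -> #|A| <= #|~: A| -> #|A :&: B| <= #|~: (A :|: B)|.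
Proof.
have : #|A| + #|~: A| = #|A :|: B| + #|~: (A :|: B)| by rewrite !cardsC.
by have := cardsUI A B; lia.
Qed.

(** * Sets that are large on both sides *)

Hypothesis gen_t : <<[set t i | i : 'I_3]>>%g = [set: gT].

Lemma boundary_large k (S : {set gT}) :
  4 * k <= g -> g <= #|S| -> g <= #|~: S| -> k <= #|boundary S|.
Proof.
move=> kg S_big SC_big; rewrite leqNgt; apply/negP=> S_small.
pose P (X : {set gT}) := [&& #|boundary X| < k, g <= #|X| & g <= #|~: X|].
have PS : P S by apply/and3P.
have [A0 PA0 minA0] := @arg_minnP _ S P (fun X => #|boundary X|) PS.
pose Q (X : {set gT}) := P X && (#|boundary X| == #|boundary A0|).
have QA0 : Q A0 by rewrite /Q PA0 eqxx.
have [A1 /andP[PA1 /eqP dA1] minA1] := @arg_minnP _ A0 Q (fun X => #|X|) QA0.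
have /set0Pn[a aA1] : A1 != set0.
  by rewrite -card_gt0; case/and3P: PA1; lia.
(* Once 1 lies in [A], every [h \in A] lies in both [A] and [h *: A]. *)
pose A : {set gT} := (a^-1 *: A1)%g.
have oneA : 1%g \in A by rewrite mem_lcoset invgK mulg1.
have cardA : #|A| = #|A1| by exact: card_lcoset.
have dA : #|boundary A| = #|boundary A0| by rewrite card_boundary_lcoset.
have cardC (X Y : {set gT}) : #|X| = #|Y| -> #|~: X| = #|~: Y|.
  by move=> eqXY; apply/eqP; rewrite -(eqn_add2l #|X|) cardsC eqXY cardsC.
have [dk Ag ACg] : [/\ #|boundary A| < k, g <= #|A| & g <= #|~: A|].
  by case/and3P: PA1; rewrite dA -dA1 cardA (cardC A A1).
have min_d (X : {set gT}) : g <= #|X| -> g <= #|~: X| ->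
    #|boundary A| <= #|boundary X|.
  move=> gX gXC; rewrite dA; case: (ltnP #|boundary X| k) => [dX|].
    by apply: minA0; apply/and3P.
  by rewrite -dA; lia.
have min_c (X : {set gT}) : g <= #|X| -> g <= #|~: X| ->
    #|boundary X| <= #|boundary A| -> #|A| <= #|X|.
  move=> gX gXC dX; rewrite cardA; apply: minA1; apply/andP; split.
    by apply/and3P; split=> //; lia.
  by rewrite eqn_leq -dA dX min_d.
(* The complement is large on both sides too and has an equally large boundary, so the minimality of
   [#|A|] applies to it. *)
have half : #|A| <= #|~: A|.
  by apply: min_c; rewrite ?setCK ?card_boundaryC.
have block h : h \in A -> (h *: A)%g = A.
  move=> hA; pose B : {set gT} := (h *: A)%g.
  have cardB : #|B| = #|A| by exact: card_lcoset.
  have dB : #|boundary B| = #|boundary A| by exact: card_boundary_lcoset.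
  apply/eqP; apply: contraT => neqBA.
  have hAB : h \in A :&: B by rewrite inE hA mem_lcoset mulVg.
  have AB_gt0 : 0 < #|A :&: B| by rewrite card_gt0; apply/set0Pn; exists h.
  have cI := cardsID B A; have cI' := cardsID A B.
  rewrite setIC in cI'.
  have AD_gt0 : 0 < #|A :\: B|.
    rewrite card_gt0 setD_eq0; apply: contra neqBA => sAB.
    by rewrite eq_sym eqEcard -/B sAB cardB leqnn.
  have subm := boundary_submodular A B; have subD := boundary_setD A B.
  have outU := setU_compl_ge (esym cardB) half.
  have sub_compl (X Y : {set gT}) : X \subset Y -> #|~: Y| <= #|~: X|.
    by move=> sXY; rewrite subset_leq_card // setCS.
  have CI := sub_compl _ _ (subsetIl A B).
  have CD := sub_compl _ _ (subsetDl A B).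
  have CD' := sub_compl _ _ (subsetDl B A).
  have CB : #|~: B| = #|~: A| by exact: cardC.
  have geU := subset_leq_card (subsetUl A B).
  (* If [A :&: B] is large, so is the complement of [A :|: B], and submodularity
     contradicts the choice of [A]; likewise for [A :\: B] and [B :\: A]. *)
  have small_I : #|A :&: B| < g.
    rewrite ltnNge; apply/negP=> gI.
    have := min_d (A :|: B); have := min_c (A :&: B); lia.
  have small_D : #|A :\: B| < g.
    rewrite ltnNge; apply/negP=> gD.
    have := min_d (B :\: A); have := min_c (A :\: B); lia.
  (* Both pieces have boundary below [2 * k], hence fewer than [2 * k] elements each; but together
     they make up [A], which has at least [4 * k]. *)
  have := boundary_small (S := A :&: B); have := boundary_small (S := A :\: B).
  rewrite AB_gt0 AD_gt0 small_I small_D => /(_ isT) bD /(_ isT) bI.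
  lia.
have grpA : group_set A.
  apply/group_setP; split=> // x y xA yA.
  by rewrite -(block x xA) mem_lcoset mulKg.
have tA i : t i \in A.
  apply: contraT => tiA.
  have : #|[set (x, i) | x in A]| <= #|boundary A|.
    apply/subset_leq_card/subsetP=> p /imsetP[x xA ->].
    rewrite inE xA /=; apply: contra tiA => xtA.
    by move: (groupMl (G := Group grpA) (t i) xA) => /= <-.
  rewrite card_imset => [|x y [] //]; lia.
have : <<[set t i | i : 'I_3]>>%g \subset Group grpA.
  by rewrite gen_subG; apply/subsetP=> _ /imsetP[i _ ->].
rewrite gen_t subTset /= => /eqP AT.
by move: ACg; rewrite AT setCT cards0; lia.
Qed.

(** * Connectedness and edge cuts *)

Lemma connect_cayley (x y : cayley) : connect (@adj cayley) x y.
Proof.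
suff conn1 z : connect (@adj cayley) (1%g : gT) z.
  apply: (connect_trans _ (conn1 y)).
  by rewrite (sym_connect_sym (@adj_sym cayley)) conn1.
have : z \in <<[set t i | i : 'I_3]>>%g by rewrite gen_t inE.
case/gen_prodgP=> n [c ct ->]; elim: n c ct => [|n IHn] c ct.
  by rewrite big_ord0 connect0.
rewrite big_ord_recr /=.
have /imsetP[i _ ->] := ct ord_max.
apply: (connect_trans (IHn (fun j => c (widen_ord (leqnSn n) j)) _)) => [j|].
  exact: ct.
exact/connect1/cayley_adj_mulr.
Qed.

Lemma connected_cayley : connected cayley.
Proof.
rewrite /connected /components (_ : imset _ _ = [set setT]) ?cards1 //.
apply/setP=> A; rewrite inE; apply/imsetP/eqP=> [[x _ ->]|->].
  by apply/setP=> y; rewrite !inE connect_cayley.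
by exists (1%g : gT) => //; apply/setP=> y; rewrite !inE connect_cayley.
Qed.

(** A boundary pair is determined by its edge, since only its start lies in [S]. *)
Lemma boundary_edges (F : {set {set cayley}}) (S : {set cayley}) :
  (forall x y, x \in S -> y \notin S -> adj x y -> [set x; y] \in F) ->
  #|boundary S| <= #|F|.
Proof.
move=> cutF.
pose e (p : gT * 'I_3) : {set cayley} := [set p.1; (p.1 * t p.2)%g].
have e_inj : {in boundary S &, injective e}.
  move=> [x i] [y j]; rewrite !inE /= => /andP[xS xiS] /andP[yS yjS] eq_e.
  have eq_xy : x = y.
    have : x \in e (y, j) by rewrite -eq_e !inE eqxx.
    rewrite !inE /= => /orP[/eqP//|/eqP xy].
    by rewrite -xy xS in yjS.
  have : (x * t i)%g \in e (y, j) by rewrite -eq_e !inE eqxx orbT.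
  rewrite !inE /= => /orP[/eqP xy|/eqP]; first by rewrite xy yS in xiS.
  by rewrite eq_xy => /mul_t_inj->.
rewrite -(card_in_imset e_inj) subset_leq_card //.
apply/subsetP=> _ /imsetP[[x i] /[!inE] /= /andP[xS xiS] ->].
by apply: cutF => //; exact: cayley_adj_mulr.
Qed.

(** All edges leaving the component [A] are in [F], and the cycles in [A] and in the disjoint
    component [B] make both sides large. *)
Lemma cayley_not_separating k (F : {set {set cayley}}) :
  4 * k <= g -> #|F| < k -> ~ cyclically_separating F.
Proof.
move=> kg Fk [A [B [/imsetP[x _ defA] /imsetP[y _ defB] neqAB cycA cycB]]].
have symF := sym_connect_sym (@adj_sym (del_edges F)).
have lift (X : {set del_edges F}) : contains_cycle X -> g <= #|X|.
  case=> c [[/andP[cc uc] sc] cX]; apply: cycle_card_ge.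
  exists c; split=> //; split=> //; rewrite /ucycle uc andbT.
  by apply: sub_cycle cc => u v /andP[].
have gB : g <= #|~: A|.
  apply: leq_trans (lift B cycB) _; apply/subset_leq_card/subsetP=> z.
  rewrite defA defB !inE => yz; apply: contra neqAB => xz.
  rewrite defA defB; apply/eqP/setP=> u; rewrite !inE.
  apply: same_connect => //; apply: connect_trans xz _.
  by rewrite symF.
have := boundary_large kg (lift A cycA) gB.
suff : #|boundary A| <= #|F| by lia.
apply: boundary_edges => u v; rewrite defA !inE => xu xv uv.
apply: contraR xv => uvF; apply: connect_trans xu (connect1 _).
by apply/andP.
Qed.

(** * Consequences of the bits: order, bipartition, disjoint cycles *)

(** Right multiplication by [t i] matches the two values of [psi] on [S]. *)
Lemma card_flip (S : {set gT}) (psi : gT -> bool) i :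
  (forall x, x \in S -> (x * t i)%g \in S) ->
  (forall x, psi (x * t i)%g = ~~ psi x) ->
  #|S| = 2 * #|[set x in S | psi x]|.
Proof.
move=> S_t psi_t; set S1 := [set x in S | psi x].
have -> : #|S| = #|S1| + #|[set (x * t i)%g | x in S1]|.
  rewrite -(cardsID [set x | psi x] S); congr (_ + _).
    by apply: eq_card => x; rewrite !inE andbC.
  apply: eq_card => x; rewrite !inE; apply/andP/imsetP=> [[px xS]|[y]].
    exists (x * t i)%g; last by rewrite mul_tK.
    by rewrite inE S_t // psi_t px.
  by rewrite inE => /andP[yS py] ->; rewrite psi_t py S_t.
by rewrite card_imset ?addnn ?mul2n //; exact: mulIg.
Qed.

Variable psi : 'I_3 -> gT -> bool.
Hypothesis psi_t : forall j x i, psi j (x * t i)%g = psi j x (+) (i == j).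

Lemma card_cayley_mod4 : 4 %| #|gT|.
Proof.
pose i0 : 'I_3 := ord0; pose i1 : 'I_3 := inord 1.
have i01 : i0 != i1 by rewrite -val_eqE /= inordK.
have psi_tt j x : psi j (x * t j)%g = ~~ psi j x by rewrite psi_t eqxx addbT.
(* Bit [i0] halves the group; [t i1] keeps bit [i0], so bit [i1] halves the remaining half. *)
rewrite -cardsT (@card_flip _ (psi i0) i0) //; last by move=> x _; rewrite inE.
rewrite (@card_flip _ (psi i1) i1) //; last first.
  by move=> x; rewrite !inE psi_t eq_sym (negPf i01) addbF.
by rewrite mulnA dvdn_mulr.
Qed.

(** Every edge flips exactly one bit, hence the parity of all three. *)
Lemma bipartite_cayley : bipartite cayley.
Proof.
pose parity x := \big[addb/false]_j psi j x.
have parity_t x i : parity (x * t i)%g = ~~ parity x.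
  rewrite /parity (eq_bigr _ (fun j _ => psi_t j x i)) big_split /= -addbT.
  congr (_ (+) _); rewrite (bigD1 i) //= eqxx big1 // => j.
  by rewrite eq_sym => /negPf.
exists [set x : cayley | parity x] => x y /cayley_adjP[i ->].
by rewrite !inE parity_t; case: (parity x).
Qed.

(** Two generators keep bit [ord_max], so both of its level sets have minimum degree at least
    two. *)
Lemma two_disjoint_cycles_cayley : two_disjoint_cycles cayley.
Proof.
pose S b := [set x : cayley | psi ord_max x == b].
have cyc b : contains_cycle (S b).
  apply: min_degree2_cycle => [|x].
    apply/set0Pn; have [p1|p1] := eqVneq (psi ord_max 1%g) b.
      by exists (1%g : gT); rewrite inE p1.
    exists (1 * t ord_max)%g; rewrite inE psi_t eqxx addbT.
    by case: b (psi _ _) p1 => [] [].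
  rewrite inE => /eqP px; apply/card_gt1P.
  have stay i : i != ord_max -> (x * t i)%g \in neighbours x :&: S b.
    move=> /negPf im; rewrite !inE psi_t im addbF px eqxx andbT.
    exact: cayley_adj_mulr.
  exists (x * t ord0)%g, (x * t (inord 1))%g.
  split; try by apply: stay; rewrite -val_eqE /= ?inordK.
  by rewrite (inj_eq (@mul_t_inj x)) -val_eqE /= inordK.
have [c1 [cyc1 c1S]] := cyc true; have [c2 [cyc2 c2S]] := cyc false.
exists c1, c2; split=> //.
apply/pred0P=> x /=; apply/negP=> /andP[/c1S + /c2S].
by rewrite !inE => /eqP->.
Qed.

End CayleyGraph.

(** * The action on the truncated tree *)

Section TreeAction.
Variable d : nat.

(* Left multiplication by [i] in the free product of three copies of Z/2,
   truncated to the ball of radius [d]. *)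
Definition step i (v : seq 'I_3) :=
  if ohead v == Some i then behead v else if size v < d then i :: v else v.

(** After a head [i] is deleted from a reduced word, the new head is not [i], so the second step
    restores it. *)
Lemma stepP i v : reduced v -> size v <= d ->
  [/\ reduced (step i v), size (step i v) <= d & step i (step i v) = v].
Proof.
rewrite /step; case: v => [|j v] /=.
  by move=> _ _; case d_gt0: (0 < d); rewrite /= ?eqxx ?d_gt0.
move=> red sv; have -> : (Some j == Some i) = (j == i) by [].
have [<-|ji] := eqVneq j i.
  split; [exact: path_sorted red | exact: ltnW | rewrite sv].
  case: v red {sv} => //= h v /andP[jh _]; rewrite ifF //.
  by apply: contraNF jh => /eqP[->].
case: ltnP => lt_d; last first.
  split=> //; rewrite ifF; first by rewrite ltnNge lt_d.
  by apply: contraNF ji => /eqP[->].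
by rewrite /= eqxx eq_sym ji red lt_d.
Qed.

Definition point := (d.-bseq 'I_3 * {ffun 'I_3 -> bool})%type.

(** Words that are not reduced stay fixed, which makes the map an involution on the whole type. *)
Definition move_point i (p : point) : point :=
  (if reduced p.1 then insub_bseq d (step i p.1) else p.1,
   [ffun j => p.2 j (+) (i == j)]).

Lemma val_insub_bseq (s : seq 'I_3) :
  size s <= d -> insub_bseq d s = s :> seq _.
Proof. by move=> sd; rewrite /insub_bseq val_insubd sd. Qed.

Lemma move_pointK i : involutive (move_point i).
Proof.
case=> v b; rewrite /move_point /=; congr pair; last first.
  by apply/ffunP=> j; rewrite !ffunE -addbA addbb addbF.
case red: (reduced v); last by rewrite red.
have [red' size' stepK] := stepP i red (size_bseq v).
apply: val_inj; rewrite /= !val_insub_bseq // red' stepK.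
by rewrite val_insub_bseq ?size_bseq.
Qed.

Definition tree_perm i : {perm point} := perm (inv_inj (@move_pointK i)).

Lemma tree_permK i : (tree_perm i * tree_perm i = 1)%g.
Proof. by apply/permP=> p; rewrite permM !permE move_pointK. Qed.

(** Permutations compose left to right, so letters are prepended one by one; reducedness excludes
    cancellation, the length bound truncation. *)
Lemma tree_perm_word w (p : point) :
  reduced (catrev w p.1) -> size w + size p.1 <= d ->
  ((\prod_(i <- w) tree_perm i)%g p).1 = catrev w p.1 :> seq _.
Proof.
elim: w p => [|i w IHw] p /=; first by rewrite big_nil perm1.
move=> red sp; rewrite big_cons permM permE.
have red_ip : reduced (i :: p.1).
  by move: red; rewrite catrevE => /cat_sorted2[].
have p1E : (move_point i p).1 = i :: p.1 :> seq _.
  rewrite /= (_ : reduced p.1); last exact: path_sorted red_ip.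
  rewrite /step ifF; last first.
    case: (p.1 : seq _) red_ip => //= j v /andP[ij _].
    by apply: contraNF ij => /eqP[->].
  have lt_d : size p.1 < d by apply: leq_trans sp; rewrite addSn ltnS leq_addl.
  by rewrite lt_d val_insub_bseq.
by rewrite IHw p1E //= addnS.
Qed.

(** The product carries the empty word to [rev w], which is not empty. *)
Lemma tree_perm_girth w : reduced w -> 0 < size w <= d ->
  (\prod_(i <- w) tree_perm i)%g != 1%g.
Proof.
move=> red /andP[w_gt0 wd]; apply/eqP=> w1.
have red' : reduced (rev w).
  by rewrite /reduced rev_sorted; apply: sub_sorted red => i j; rewrite eq_sym.
have := @tree_perm_word w ([bseq], [ffun=> false]).
rewrite w1 perm1 /= addn0 => /(_ red' wd) /(congr1 size) /=.
by rewrite size_rev; lia.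
Qed.

End TreeAction.

(** * Assembling the graph *)

(** Lets a generated subgroup serve as a group type of its own. As [sgval] is injective, comparing
    images suffices. *)
Lemma subg_generated (gT : finGroupType) (I : finType) (t : I -> gT) :
  let G := <<[set t i | i : I]>>%G in
  <<[set subg G (t i) | i : I]>>%g = [set: subg_of G].
Proof.
set G := <<_>>%G => /=; set H := <<_>>%g.
have tG i : t i \in G by apply/mem_gen/imset_f.
apply/eqP; rewrite eqEsubset subsetT /=; apply/subsetP=> x _.
have : sgval x \in (sgval @* H)%g.
  have -> : (sgval @* H)%g = G; last exact: subgP.
  rewrite morphim_gen ?subsetT //; congr generated.
  rewrite morphimEsub ?subsetT // -imset_comp.
  by apply: eq_imset => i /=; rewrite subgK.
by case/morphimP=> y _ yH /val_inj->.
Qed.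

Theorem proposition4 (k : nat) (k_gt0 : 0 < k) :
  exists G : sgraph,
    [/\ cyclically_edge_connected k G, bipartite G, cubic G &
        #|G| = 0 %[mod 4]].
Proof.
pose G := <<[set tree_perm (4 * k) i | i : 'I_3]>>%G.
pose t i : subg_of G := subg G (tree_perm (4 * k) i).
have val_t i : sgval (t i) = tree_perm (4 * k) i.
  by rewrite subgK //; apply/mem_gen/imset_f.
have valM (x y : subg_of G) : sgval (x * y)%g = (sgval x * sgval y)%g by [].
have tt i : (t i * t i = 1)%g.
  by apply: val_inj; rewrite [LHS]valM val_t tree_permK.
(* The bits are read off the image of a base point; they also tell the generators apart from each
   other and from 1. *)
pose psi j (x : subg_of G) := (sgval x ([bseq], [ffun=> false])).2 j.
have psi_t j x i : psi j (x * t i)%g = psi j x (+) (i == j).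
  by rewrite /psi valM permM val_t permE ffunE.
have t_inj : injective t.
  move=> i j eq_t; have := psi_t j 1%g i.
  by rewrite eq_t psi_t eqxx => /addbI/esym/eqP.
have t_neq1 i : t i != 1%g.
  apply/eqP=> ti1; have := psi_t i 1%g i.
  by rewrite ti1 mulg1 eqxx; case: (psi i 1%g).
(* The bound on word length is strict, so radius [4 * k] gives girth at least [4 * k + 1]. *)
have girth w : reduced w -> 0 < size w < (4 * k).+1 ->
    (\prod_(i <- w) t i)%g != 1%g.
  move=> red sw; have := tree_perm_girth red sw.
  apply: contraNneq => w1; apply/eqP.
  rewrite -[RHS](_ : sgval (1%g : subg_of G) = 1%g) // -w1.
  rewrite (big_morph _ valM (erefl _)).
  by apply: eq_bigr => i _; rewrite val_t.
have gen_t : <<[set t i | i : 'I_3]>>%g = [set: subg_of G].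
  exact: subg_generated.
have cubicG : cubic (cayley tt t_neq1) by exact: cubic_cayley.
exists (cayley tt t_neq1); split=> //.
- split=> //.
  + exact: connected_cayley.
  + exact: two_disjoint_cycles_cayley psi_t.
  move=> F _ Fk; apply: (cayley_not_separating t_inj girth gen_t (k := k)).
    exact: leqnSn.
  by rewrite (leq_ltn_trans Fk) // subn1 prednK.
- exact: bipartite_cayley psi_t.
- by rewrite mod0n; apply/eqP; exact: (card_cayley_mod4 tt psi_t).
Qed.
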